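(* Let $G$ be a finite simple graph (not necessarily connected) with $n$ vertices that is $k$-regular, where $k\geq 1$. If $k$ is odd, then $G$ is $\left(\frac{nk}{2}-1\right)$-approximately magic. If $k$ is even, then $G$ is $\left(\frac{2n}{3}+k-1\right)$-approximately magic.
   Context: For a graph with $m$ edges, a labeling is a bijection $f$ from the edge set to $\{1,\ldots,m\}$; the vertex sum at a vertex $v$ is the sum of $f(e)$ over all edges $e$ incident with $v$. A labeling is $\delta$-approximately magic if the difference between the largest and the smallest vertex sums is at most $\delta$. A graph is $\delta$-approximately magic if it admits a $\delta$-approximately magic labeling. *)

(* Defs.v *)
From mathcomp Require Import all_boot all_order all_algebra.

Set Implicit Arguments.
Unset Strict Implicit.
Unset Printing Implicit Defensive.

Import Order.TTheory GRing.Theory Num.Theory.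

Definition simple_graph (T : finType) (e : rel T) : Prop :=
  symmetric e /\ irreflexive e.

Definition regular_graph (T : finType) (e : rel T) (k : nat) : Prop :=
  forall v : T, #|[set w | e v w]| = k.

Definition edges (T : finType) (e : rel T) : {set {set T}} :=
  [set [set p.1; p.2] | p : T * T & e p.1 p.2].

(* f restricts to a bijection from the edge set onto {1, ..., m}; its values
   on sets that are not edges are irrelevant. *)
Definition labeling (T : finType) (e : rel T) (f : {set T} -> nat) : Prop :=
  [/\ forall a, a \in edges e -> 1 <= f a <= #|edges e|,
      {in edges e &, injective f}
    & forall i, 1 <= i <= #|edges e| -> exists2 a, a \in edges e & f a = i].

Definition vertex_sum (T : finType) (e : rel T) (f : {set T} -> nat) (v : T)
    : nat :=
  \sum_(a in edges e | v \in a) f a.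

(* u and v range over the vertices with the largest and the smallest sums, so
   the condition holds trivially for the graph without vertices.
   The bound delta need not be an integer. *)
Definition approx_magic_labeling (T : finType) (e : rel T) (delta : rat)
    (f : {set T} -> nat) : Prop :=
  labeling e f /\
  forall u v : T,
    (forall w, vertex_sum e f w <= vertex_sum e f u) ->
    (forall w, vertex_sum e f v <= vertex_sum e f w) ->
    ((vertex_sum e f u)%:R - (vertex_sum e f v)%:R <= delta)%R.

Definition approx_magic (T : finType) (e : rel T) (delta : rat) : Prop :=
  exists f : {set T} -> nat, approx_magic_labeling e delta f.

(* Main.v *)
Require Import Defs.
From mathcomp Require Import all_boot all_order all_algebra.
From mathcomp Require Import zify lra.

Set Implicit Arguments.
Unset Strict Implicit.
Unset Printing Implicit Defensive.

(** Decompose the edges into as few trails as possible.  Two trails sharing an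
    end could be joined, so every vertex is an end of at most one trail.

    If [k] is odd, parity makes every vertex the end of exactly one trail, hence
    there are [n/2] trails and one of them has length at least [k].  Concatenate
    the trails, that one first, and label 1, m, 2, m-1, ...: consecutive labels
    sum to [m+1] or [m+2], and the large labels m, m-1, ... used inside the
    first trail never occur at an end.  A vertex sum is thus an end label in
    [1, m-(k-1)/2] plus [(k-1)/2] sums of consecutive labels.

    If [k] is even, all trails are closed.  Among such decompositions take one
    whose odd trails have minimal total length: two odd trails through a vertex
    could be merged into an even one, and an odd trail visiting a vertex twice
    could be split into an odd and an even one.  So the [c] odd trails visit
    every vertex at most once altogether, and [3c <= n].  There is a labeling
    whose consecutive labels sum to [m+1] up to an error of 1 on even trails and
    of [c] on odd ones, and the errors at a vertex add up to at most
    [k/2 - 1 + max(1, c)]. *)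

(** * Label patterns for closed trails: levels and sums of adjacent labels *)

Lemma ltn_sum_ord d (F G : nat -> nat) i :
  i < d -> (forall x, x < d -> F x <= G x) -> F i < G i ->
  \sum_(x < d) F x < \sum_(x < d) G x.
Proof.
move=> lid leFG ltFG; rewrite (bigD1 (Ordinal lid)) //=.
rewrite [X in _ < X](bigD1 (Ordinal lid)) //= -addSn leq_add //.
by apply: leq_sum => x _; apply: leFG.
Qed.

Lemma sum_ltn_ord d i : i <= d -> \sum_(x < d) (x < i) = i.
Proof.
elim: d => [|d IH] lid; first by rewrite big_ord0; lia.
rewrite big_ord_recr /=.
case: (leqP i d) => [lid'|ldi]; first by rewrite IH //; lia.
have -> : \sum_(x < d) (x < i) = \sum_(x < d) 1.
  by apply: eq_bigr => x _; have := ltn_ord x; lia.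
by rewrite sum1_card card_ord; lia.
Qed.

Section LevelLabels.

Variables (d c : nat) (len : nat -> nat).
Hypothesis le_cd : c <= d.
Hypothesis odd_len : forall i, i < d -> odd (len i) = (i < c).
Hypothesis len_gt1 : forall i, i < d -> 1 < len i.

(* With Y := total_half and m = 2Y + c, the labels are the low ones Y - y, the
   middle ones Y + 1 + i (i < c) and the high ones Y + c + 1 + y, for y < Y, so
   that a low and a high label sum to m + 1 up to the difference of their
   levels y.  The odd trails come first; trail i < c takes the middle label
   Y + 1 + i, and then, as an even trail does from its start, alternates low
   and high labels, going up in levels along its first half (b = true) and down
   again along the second half (b = false). *)
Definition half_len i := (len i)./2.
Definition total_half := \sum_(x < d) half_len x.

Definition level_bound (i : nat) (b : bool) (j x : nat) : nat :=
  if i < c then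
    (if x < c then minn (half_len x) (j + (if b then x < i else i < x)) else 0)
  else if (x < c) || (x < i) then half_len x else if x == i then j else 0.

(* For i < c this is the rank of (i, j) when the steps j of all odd trails are
   ordered lexicographically by j and then by increasing (b = true) or
   decreasing (b = false) i; the even trails occupy consecutive blocks of
   levels after that.  As a sum over trails x, each term changes by at most one
   when j is incremented or b is flipped. *)
Definition level i b j := \sum_(x < d) level_bound i b j x.

Lemma level_ltn_total i b j :
  i < d -> j < half_len i -> level i b j < total_half.
Proof.
by move=> lid lj; apply: (ltn_sum_ord lid) => [x lx|]; rewrite /level_bound;
  repeat case: ifP => ?; try lia;
  have ? : x = i by [lia]; subst x; lia.
Qed.

(** The two sums compare term by term, strictly at [x = i]: there the left term is exactly [j],
    below the cap [half_len i]. *)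
Lemma level_ltn i b j i' b' j' : i < d -> i' < d ->
  j < half_len i -> j' < half_len i' -> (i < c -> i' < c -> j < j') ->
  (c <= i -> c <= i' /\ (i < i' \/ i = i' /\ j < j')) ->
  level i b j < level i' b' j'.
Proof.
by move=> lid lid' lj lj' H1 H2; apply: (ltn_sum_ord lid) => [x lx|];
  rewrite /level_bound; repeat case: ifP => ?; try lia;
  have ? : x = i \/ x = i' by [lia]; intuition (subst x; lia).
Qed.

Lemma level_ltn_same i b j i' : i < i' -> i' < c -> j < half_len i ->
  j < half_len i' -> if b then level i b j < level i' b j
                     else level i' b j < level i b j.
Proof.
by move=> lii' li' lj lj'; case: b;
  [apply: (@ltn_sum_ord _ _ _ i) | apply: (@ltn_sum_ord _ _ _ i')];
  rewrite /level_bound; try (move=> x lx); repeat case: ifP => ?; lia.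
Qed.

(** The two directions rank the same [j] in opposite orders of the trails, so levels of opposite
    direction can coincide; hence the hypothesis linking [b] and [b']. *)
Lemma level_inj i b j i' b' j' : i < d -> i' < d ->
  j < half_len i -> j' < half_len i' -> (j = j' -> b = b') ->
  level i b j = level i' b' j' -> i = i' /\ j = j'.
Proof.
move=> lid lid' lj lj' Hb E.
have N1 := @level_ltn i b j i' b' j' lid lid' lj lj'.
have N2 := @level_ltn i' b' j' i b j lid' lid lj' lj.
case: (ltngtP j j') => [ljj|ljj|Ej]; try lia.
have Eb := Hb Ej; subst j' b'.
have N3 := @level_ltn_same i b j i'; have N4 := @level_ltn_same i' b j i.
by case: (ltngtP i i') => // lii; clear Hb; case: b N1 N2 N3 N4 E => *; lia.
Qed.

(** Bounds the change of [level] in one step along trail [i]: on an odd trail each of the [c] terms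
    of odd trails may move by one, on an even trail only its own term moves. *)
Definition window i := if i < c then c else 1.

Lemma sum_window (F G : nat -> nat) i : i < d ->
  (forall x, x < d ->
     F x <= G x + (if i < c then x < c : nat else x == i : nat)) ->
  \sum_(x < d) F x <= \sum_(x < d) G x + window i.
Proof.
move=> lid H.
suff <- : \sum_(x < d)
    (if i < c then x < c : nat else x == i :> nat : nat) = window i.
  by rewrite -big_split; apply: leq_sum => x _; apply: H.
rewrite /window; case: ifP => _; first exact: sum_ltn_ord.
rewrite (bigD1 (Ordinal lid)) //= eqxx big1 // => x /eqP nx.
by apply/eqP; rewrite eqb0; apply/eqP => E; apply: nx; apply: val_inj.
Qed.

Lemma level_step i b j : i < d ->
  level i b j <= level i b j.+1 <= level i b j + window i.
Proof.
move=> lid; apply/andP; split.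
  by apply: leq_sum => x _; rewrite /level_bound; repeat case: ifP => ?; lia.
by apply: sum_window => // x lx; rewrite /level_bound;
  repeat case: ifP => ?; try lia; have ? : x = i by [lia]; subst x; lia.
Qed.

Lemma level_turn i b b' j : i < d -> level i b j <= level i b' j + window i.
Proof.
by move=> lid; apply: sum_window => // x lx; rewrite /level_bound;
  repeat case: ifP => ?; try lia; have ? : x = i by [lia]; subst x; lia.
Qed.

Lemma level_even i b b' j : c <= i -> level i b j = level i b' j.
Proof. by move=> lci; apply: eq_bigr => x _; rewrite /level_bound ltnNge lci. Qed.

(** At [j = 0] only the [i] odd trails before trail [i] contribute, one each. This balances the
    middle label against the first low label. *)
Lemma level0_out i : i < c -> level i true 0 <= i.
Proof.
move=> lic; rewrite -[X in _ <= X](@sum_ltn_ord d); last by lia.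
by apply: leq_sum => x _; rewrite /level_bound; repeat case: ifP => ?; lia.
Qed.

(** Here only the [c - 1 - i] odd trails after trail [i] contribute. This balances the last high
    label against the middle label. *)
Lemma level0_ret i : i < c -> i + level i false 0 < c.
Proof.
move=> lic; rewrite -addSn -{1}[i.+1](@sum_ltn_ord d); last by lia.
rewrite -[X in _ <= X](@sum_ltn_ord d) // -big_split.
by apply: leq_sum => x _; rewrite /level_bound /=; repeat case: ifP => ?; lia.
Qed.

Definition half_label i q :=
  let j := if q < half_len i then q else (half_len i).*2.-1 - q in
  let y := level i (q < half_len i) j in
  if odd q then total_half + c + 1 + y else total_half - y.

Definition level_label i q :=
  if i < c then
    (if q is q'.+1 then half_label i q' else total_half + 1 + i)
  else half_label i q.

Definition level_count := total_half.*2 + c.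

Lemma half_label_inj i q i' q' : i < d -> i' < d ->
  q < (half_len i).*2 -> q' < (half_len i').*2 ->
  half_label i q = half_label i' q' -> i = i' /\ q = q'.
Proof.
move=> lid lid' lq lq'; rewrite /half_label.
set j := if q < _ then _ else _; set j' := if q' < _ then _ else _.
have lj : j < half_len i by rewrite /j; case: ifP => ?; lia.
have lj' : j' < half_len i' by rewrite /j'; case: ifP => ?; lia.
have L := @level_ltn_total i (q < half_len i) j lid lj.
have L' := @level_ltn_total i' (q' < half_len i') j' lid' lj'.
move=> E; have Eo : odd q = odd q' by move: E; case: ifP; case: ifP; lia.
have Ey : level i (q < half_len i) j = level i' (q' < half_len i') j'.
  by move: E; rewrite Eo; case: ifP => _; lia.
have [Ei Ej] : i = i' /\ j = j'.
  (* A position and its mirror image in the other half share [j] but have opposite parities, so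
     equal parity and equal [j] force the same half. *)
  apply: level_inj Ey => //; rewrite /j /j'.
  by case: ifP => ?; case: ifP => ?; lia.
by subst i'; split=> //; move: Ej; rewrite /j /j'; do 2![case: ifP => ?]; lia.
Qed.

Lemma half_label_range i q : i < d -> q < (half_len i).*2 ->
  if odd q then total_half + c + 1 <= half_label i q <= level_count
  else 1 <= half_label i q <= total_half.
Proof.
move=> lid lq; rewrite /half_label /level_count.
set j := if q < _ then _ else _.
have lj : j < half_len i by rewrite /j; case: ifP => ?; lia.
have := @level_ltn_total i (q < half_len i) j lid lj.
by case: (odd q) => /=; lia.
Qed.

Lemma len_half i : i < d -> len i = (i < c) + (half_len i).*2.
Proof. by move=> lid; rewrite -odd_len // /half_len odd_double_half. Qed.

Lemma level_count_sum : level_count = \sum_(i < d) len i.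
Proof.
rewrite (eq_bigr (fun i : 'I_d => (i < c) + 2 * half_len i)) => [|i _].
  by rewrite big_split -big_distrr sum_ltn_ord // /level_count /total_half /=; lia.
by rewrite len_half // mul2n.
Qed.

Lemma level_label_range i q :
  i < d -> q < len i -> 1 <= level_label i q <= level_count.
Proof.
move=> lid; rewrite len_half // /level_label; case: ifP => lic; last first.
  by move=> lq; have := @half_label_range i q lid; case: ifP; rewrite /level_count; lia.
case: q => [|q] lq; first by rewrite /level_count; lia.
by have := @half_label_range i q lid; case: ifP; rewrite /level_count; lia.
Qed.

Lemma level_label_inj i q i' q' : i < d -> i' < d -> q < len i -> q' < len i' ->
  level_label i q = level_label i' q' -> i = i' /\ q = q'.
Proof.
move=> lid lid'; rewrite !len_half // /level_label => lq lq'.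
case: ifP lq => lic; case: ifP lq' => lic'; first 1 last.
- case: q => [|q] lq' lq E.
    by have := @half_label_range i' q' lid' lq'; case: ifP; lia.
  by have := half_label_inj lid lid' lq lq' E; lia.
- case: q' => [|q'] lq' lq E.
    by have := @half_label_range i q lid lq; case: ifP; lia.
  by have := half_label_inj lid lid' lq lq' E; lia.
- by move=> lq' lq E; apply: half_label_inj E.
case: q q' => [|q] [|q'] lq' lq E; first by lia.
- by have := @half_label_range i' q' lid' lq'; case: ifP; lia.
- by have := @half_label_range i q lid lq; case: ifP; lia.
by have := half_label_inj lid lid' lq lq' E; lia.
Qed.

Definition balanced w s := level_count.+1 <= s + w /\ s <= level_count.+1 + w.

Lemma half_label_adj i q : i < d -> q.+1 < (half_len i).*2 ->
  balanced (window i) (half_label i q + half_label i q.+1).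
Proof.
move=> lid lq; rewrite /half_label /balanced /level_count /=.
set j := if q < _ then _ else _; set j' := if q.+1 < _ then _ else _.
have lj : j < half_len i by rewrite /j; case: ifP => ?; lia.
have lj' : j' < half_len i by rewrite /j'; case: ifP => ?; lia.
have := @level_ltn_total i (q < half_len i) j lid lj.
have := @level_ltn_total i (q.+1 < half_len i) j' lid lj'.
have : level i (q < half_len i) j <= level i (q.+1 < half_len i) j' + window i
  /\ level i (q.+1 < half_len i) j' <= level i (q < half_len i) j + window i.
  (* Three cases: both positions in the rising half, both in the falling half, or the turn, where
     [j] stays and only the direction flips. *)
  rewrite /j /j'; case: (ltngtP q.+1 (half_len i)) => C.
  - by have := @level_step i true q lid; lia.
  - have -> : (half_len i).*2.-1 - q = ((half_len i).*2.-1 - q.+1).+1 by lia.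
    by have := @level_step i false ((half_len i).*2.-1 - q.+1) lid; lia.
  - have -> : (half_len i).*2.-1 - q.+1 = q by lia.
    by split; apply: level_turn.
by case: (odd q) => /=; lia.
Qed.

Lemma half_label_first i : i < d ->
  half_label i 0 = total_half - level i true 0.
Proof. by move=> lid; rewrite /half_label half_gt0 len_gt1. Qed.

Lemma half_label_last i : i < d ->
  half_label i (half_len i).*2.-1 = total_half + c + 1 + level i false 0.
Proof.
move=> lid; have := len_gt1 lid; rewrite (len_half lid) => l1.
have N : (half_len i).*2.-1 < half_len i = false by lia.
by rewrite /half_label N subnn; case: ifP => //; lia.
Qed.

Lemma level_label_adj i q : i < d -> q.+1 < len i ->
  balanced (window i) (level_label i q + level_label i q.+1).
Proof.
move=> lid; rewrite len_half // /level_label; case: ifP => lic lq; last first.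
  exact: half_label_adj.
case: q lq => [|q] lq; last exact: half_label_adj.
have h0 : 0 < half_len i by lia.
rewrite half_label_first // /balanced /window lic /level_count.
have := level0_out lic; have := level_ltn_total true lid h0; lia.
Qed.

(** On an even trail the first and last labels both have level index 0 and direction is irrelevant,
    so they sum to exactly [level_count.+1]. On an odd trail the middle label meets the last high
    one. *)
Lemma level_label_close i : i < d ->
  balanced (window i) (level_label i (len i).-1 + level_label i 0).
Proof.
move=> lid; have := len_gt1 lid; rewrite len_half // /level_label.
case: ifP => lic l1.
  have -> : ((i < c) + (half_len i).*2).-1 = (half_len i).*2.-1.+1 by lia.
  rewrite half_label_last // /balanced /window lic /level_count.
  by have := level0_ret lic; lia.
have h0 : 0 < half_len i by lia.
rewrite lic add0n half_label_last // half_label_first //.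
rewrite (@level_even i false true); last by lia.
rewrite /balanced /level_count; have := level_ltn_total true lid h0; lia.
Qed.

End LevelLabels.

(** * Trail decompositions and vertex sums along trails *)

Lemma count_gt1_perm (A : eqType) (a : pred A) (s : seq A) : 1 < count a s ->
  exists x y s', [/\ perm_eq s (x :: y :: s'), a x & a y].
Proof.
move=> c1; have /hasP[x xs ax] : has a s by rewrite has_count; lia.
have px := perm_to_rem xs.
have c2 : 0 < count a (rem x s) by move: c1; rewrite (permP px) /= ax; lia.
have /hasP[y ys ay] : has a (rem x s) by rewrite has_count.
exists x, y, (rem y (rem x s)); split=> //.
by apply: perm_trans px _; rewrite perm_cons perm_to_rem.
Qed.

Section Trails.

Variables (T : finType) (e : rel T).
Hypothesis He : simple_graph e.

Definition trail_edges (t : T * seq T) : seq {set T} :=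
  pairmap (fun x y => [set x; y]) t.1 t.2.

(** Distinctness of the edges is left to [trail_decomp], whose edge list is a permutation of a
    duplicate-free enumeration. *)
Definition is_trail (t : T * seq T) := path e t.1 t.2 && (t.2 != [::]).

Definition trail_decomp (D : seq (T * seq T)) :=
  all is_trail D && perm_eq (flatten (map trail_edges D)) (enum (edges e)).

Definition has_end (v : T) (t : T * seq T) := (v == t.1) || (v == last t.1 t.2).

Lemma trail_edges_cat x p q :
  trail_edges (x, p ++ q) = trail_edges (x, p) ++ trail_edges (last x p, q).
Proof. by rewrite /trail_edges /= pairmap_cat. Qed.

Lemma last_rev_belast (x : T) p : last (last x p) (rev (belast x p)) = x.
Proof. by case: p => //= y q; rewrite rev_cons last_rcons. Qed.

Lemma trail_edges_rev x p :
  trail_edges (last x p, rev (belast x p)) = rev (trail_edges (x, p)).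
Proof.
elim: p x => //= y q IH x; rewrite rev_cons -cats1 trail_edges_cat IH.
by rewrite last_rev_belast /trail_edges /= rev_cons -cats1 setUC.
Qed.

Lemma is_trail_rev x p : is_trail (last x p, rev (belast x p)) = is_trail (x, p).
Proof.
rewrite /is_trail /= rev_path; have [se _] := He.
rewrite (eq_path (e' := e)) => [|a b]; last by rewrite /= se.
by congr (_ && _); case: p => // y q; rewrite -size_eq0 size_rev.
Qed.

Lemma trail_from_end v t : is_trail t -> has_end v t ->
  exists p, is_trail (v, p) /\ perm_eq (trail_edges (v, p)) (trail_edges t).
Proof.
case: t => x p Ht /orP[/eqP->|/eqP->] /=; first by exists p.
by exists (rev (belast x p)); rewrite is_trail_rev trail_edges_rev perm_rev.
Qed.

Lemma perm_trail_decomp D D' :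
  perm_eq D D' -> trail_decomp D -> trail_decomp D'.
Proof.
move=> pD /andP[aD eD]; rewrite /trail_decomp -(perm_all _ pD) aD /=.
apply: perm_trans eD; rewrite perm_sym.
by apply: perm_flatten; apply: perm_map.
Qed.

(** Justifies all cutting and joining below: the leading trails may be replaced by any others with
    the same edges. *)
Lemma trail_decomp_sub (s s' D : seq (T * seq T)) :
  all is_trail s' ->
  perm_eq (flatten (map trail_edges s')) (flatten (map trail_edges s)) ->
  trail_decomp (s ++ D) -> trail_decomp (s' ++ D).
Proof.
move=> as' ps /andP[]; rewrite all_cat => /andP[_ aD] pD.
rewrite /trail_decomp all_cat as' aD /=; apply: perm_trans pD.
by rewrite !map_cat !flatten_cat perm_cat2r.
Qed.

Lemma trail_decomp0 : exists D, trail_decomp D.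
Proof.
suff [D /andP[aD fD]] : exists D, all is_trail D &&
    (flatten (map trail_edges D) == enum (edges e)).
  by exists D; rewrite /trail_decomp aD /= (eqP fD) perm_refl.
have : {subset enum (edges e) <= edges e} by move=> a; rewrite mem_enum.
elim: (enum _) => [|a s IH] sub; first by exists [::].
have /imsetP[[x y] /=] : a \in edges e by apply: sub; rewrite mem_head.
rewrite inE /= => exy ->; have [|D /andP[aD /eqP fD]] := IH.
  by move=> b bs; apply: sub; rewrite in_cons bs orbT.
by exists ((x, [:: y]) :: D); rewrite /= fD aD /is_trail /= exy eqxx.
Qed.

(** Induction on the number of trails: joining two trails at a common end lowers it by one. *)
Lemma trail_decomp_unique_ends : exists D, trail_decomp D /\
  forall v, count (has_end v) D <= 1.
Proof.
have [D0] := trail_decomp0; have [n] := ubnP (size D0).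
elim: n D0 => // n IH D lD dD.
case: (boolP [forall v, count (has_end v) D <= 1]) => [/forallP|]; first by exists D.
rewrite negb_forall => /existsP[v]; rewrite -ltnNge.
case/count_gt1_perm => t1 [t2] [D' [pD h1 h2]].
have := perm_trail_decomp pD dD; rewrite -[_ :: _]/([:: t1; t2] ++ D') => dD'.
have /and3P[i1 i2 _] : all is_trail (t1 :: t2 :: D') by case/andP: dD'.
have [p1 [+ e1]] := trail_from_end i1 h1.
have [p2 [+ e2]] := trail_from_end i2 h2.
(* The first trail is reversed so that it arrives at [v], where the second one departs. *)
rewrite -[is_trail (v, p1)]is_trail_rev => /andP[/= pa2 n2] /andP[/= pa1 n1].
apply: (IH ((last v p1, rev (belast v p1) ++ p2) :: D')).
  by move: lD; rewrite ltnS (perm_size pD) /=; apply: leq_trans.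
rewrite -cat1s; apply: trail_decomp_sub dD'.
  rewrite /= andbT /is_trail /= cat_path pa1 last_rev_belast pa2 /=.
  by case: (p2) n2 => // a l _; case: (rev _).
rewrite /= !cats0 trail_edges_cat last_rev_belast trail_edges_rev.
by rewrite perm_cat // perm_rev.
Qed.

Lemma edges_loopless a : a \in edges e -> #|a| = 2.
Proof.
case/imsetP=> -[x y]; rewrite inE /= => exy ->; rewrite cards2.
by case: eqVneq exy => // ->; have [_ ->] := He.
Qed.

Lemma card_incident v :
  \sum_(a in edges e | v \in a) 1 = #|[set w | e v w]|.
Proof.
rewrite -(card_in_imset (f := fun w => [set v; w])) => [|x y].
  rewrite sum1dep_card; apply: eq_card => a; rewrite inE.
  apply/andP/imsetP => [[/imsetP[[x y]]]|[w]].
    rewrite inE /= => exy -> /set2P[] ->; first by exists y; rewrite ?inE.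
    by exists x; [rewrite inE; have [<-] := He | rewrite setUC].
  rewrite inE => evw ->; rewrite set21; split=> //.
  by apply/imsetP; exists (v, w); rewrite ?inE.
rewrite !inE => ex ey /setP/(_ x); rewrite set22 => /esym/set2P[] // xv.
by move: ex; rewrite xv; have [_ ->] := He.
Qed.

Lemma handshake k : regular_graph e k -> 2 * #|edges e| = #|T| * k.
Proof.
move=> Hreg; transitivity (\sum_(v : T) \sum_(a in edges e | v \in a) 1).
  rewrite (exchange_big_dep (mem (edges e))) /= => [|v a _ /andP[]//].
  rewrite -sum1_card big_distrr; apply: eq_bigr => a ae /=.
  by rewrite -(edges_loopless ae) muln1 -sum1_card; apply: eq_bigl => x; rewrite ae.
rewrite (eq_bigr (fun=> k)) => [|v _]; last by rewrite card_incident Hreg.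
by rewrite sum_nat_const.
Qed.

(** Interior visits only: [belast] drops the final vertex and [t.2] already omits the start. *)
Definition visits v (t : T * seq T) :=
  if t.2 is y :: q then count_mem v (belast y q) else 0.
Definition end_sum (F : {set T} -> nat) v (t : T * seq T) :=
  let s := trail_edges t in
  (v == t.1) * F (head set0 s) + (v == last t.1 t.2) * F (last set0 s).

(** An interior visit uses two consecutive edges, an end only one. As edges are not loops, no edge
    is counted twice at [v]. *)
Lemma trail_sum_bounds (F : {set T} -> nat) A B v t : is_trail t ->
  sorted (fun a b => A <= F a + F b <= B) (trail_edges t) ->
  end_sum F v t + A * visits v t <= \sum_(a <- trail_edges t | v \in a) F a
    <= end_sum F v t + B * visits v t.
Proof.
case: t => x [|y q]; rewrite /is_trail ?andbF // andbT /end_sum /visits /trail_edges /=.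
have loopless a b : e a b -> (v == a) && (v == b) = false.
  have [_ irr] := He.
  by move=> eab; apply/negP => /andP[/eqP va /eqP vb]; rewrite -va -vb irr in eab.
elim: q x y => [|z q IH] x y /=.
  rewrite andbT big_cons big_nil in_set2 => /loopless + _.
  by case: (v == x); case: (v == y) => //= _; lia.
case/andP=> exy pz /andP[AB so].
rewrite big_cons in_set2; move: (IH y z pz so); move: AB (loopless _ _ exy).
clear; rewrite (eq_sym y v) !mulnDr; move: (\sum_(a <- _ | _) _) => S.
by case: (v == x); case: (v == y) => //= AB _; lia.
Qed.

Lemma vertex_sum_decomp D f v : trail_decomp D ->
  vertex_sum e f v = \sum_(t <- D) \sum_(a <- trail_edges t | v \in a) f a.
Proof.
case/andP=> _ pD; rewrite /vertex_sum -big_enum_cond /= -(perm_big _ pD) /=.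
by rewrite big_flatten /= big_map.
Qed.

(** Unlike in [has_end], a closed trail counts twice at its base point. *)
Definition end_count v (t : T * seq T) := (v == t.1) + (v == last t.1 t.2).

(** The case of constant weight 1, where consecutive edges sum to exactly 2. *)
Lemma degree_decomp D v : trail_decomp D ->
  \sum_(t <- D) (end_count v t + 2 * visits v t) = #|[set w | e v w]|.
Proof.
move=> dD; rewrite -card_incident; have := vertex_sum_decomp (fun=> 1) v dD.
rewrite /vertex_sum => ->; rewrite !big_seq; apply: eq_bigr => t tD.
have it : is_trail t by case/andP: dD => /allP aD _; apply: aD.
have := @trail_sum_bounds (fun=> 1) 2 2 v t it.
rewrite /end_sum /end_count !muln1 => H.
apply/eqP; rewrite eqn_leq; apply: H.
by case: (trail_edges t) => //= a s; elim: s a => //= b s IH a; rewrite IH.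
Qed.

Lemma size_decomp D : trail_decomp D -> \sum_(t <- D) size t.2 = #|edges e|.
Proof.
case/andP=> _ /perm_size; rewrite -cardE => <-.
rewrite size_flatten /shape -map_comp sumnE big_map.
by apply: eq_bigr => t _; rewrite /= size_pairmap.
Qed.

(** Surjectivity follows by counting: [m] distinct values within a set of size [m]. *)
Lemma labeling_of_inj f :
  (forall a, a \in edges e -> 1 <= f a <= #|edges e|) ->
  {in edges e &, injective f} -> labeling e f.
Proof.
move=> fr fi; split=> // i ir.
have us : uniq (map f (enum (edges e))).
  by rewrite map_inj_in_uniq ?enum_uniq // => a b; rewrite !mem_enum; apply: fi.
have [||_ E] := uniq_min_size us (s2 := iota 1 #|edges e|).
- by move=> j /mapP[a]; rewrite mem_enum mem_iota => /fr + ->; rewrite add1n ltnS.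
- by rewrite size_iota size_map -cardE.
have : i \in iota 1 #|edges e| by rewrite mem_iota add1n ltnS.
by rewrite -E => /mapP[a]; rewrite mem_enum => ae ->; exists a.
Qed.

Lemma sum_bounds (I : eqType) (s : seq I) (F G H : I -> nat) :
  (forall t, t \in s -> F t <= G t <= H t) ->
  \sum_(t <- s) F t <= \sum_(t <- s) G t <= \sum_(t <- s) H t.
Proof.
move=> FGH; rewrite ![\sum_(t <- s) _]big_seq.
by apply/andP; split; apply: leq_sum => t /FGH /andP[].
Qed.

(** * Odd degree: labeling along the concatenated trails *)

Definition zigzag m i := if odd i then m - i./2 else i./2.+1.

Lemma zigzag_inj m i j : i < m -> j < m -> zigzag m i = zigzag m j -> i = j.
Proof. by rewrite /zigzag; do 2![case: ifP => ?]; lia. Qed.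

Lemma zigzag_range m i : i < m -> 1 <= zigzag m i <= m.
Proof. by rewrite /zigzag; case: ifP => ?; lia. Qed.

Lemma zigzag_adj m i : i.+1 < m ->
  m.+1 <= zigzag m i + zigzag m i.+1 <= m.+2.
Proof. by rewrite /zigzag; do 2![case: ifP => ?]; lia. Qed.

(** The [k./2] largest labels sit at the odd positions 1, 3, ..., k - 2, hence before position
    [k - 1]. *)
Lemma zigzag_late m k i : odd k -> k <= i.+1 -> i < m -> zigzag m i <= m - k./2.
Proof. by rewrite /zigzag; case: ifP => ?; lia. Qed.

Lemma sorted_flatten (A : Type) (r : rel A) (ss : seq (seq A)) :
  sorted r (flatten ss) -> all (sorted r) ss.
Proof.
elim: ss => //= s ss IH so; have [-> /IH ->] : sorted r s /\ sorted r (flatten ss).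
  by split; [have := take_sorted (size s) so; rewrite take_size_cat
            | have := drop_sorted (size s) so; rewrite drop_size_cat].
by [].
Qed.

(** The number of ends at [v] has the parity of [k], and a single trail supplies at most two. *)
Lemma odd_end_count k D v : regular_graph e k -> odd k -> trail_decomp D ->
  count (has_end v) D <= 1 -> \sum_(t <- D) end_count v t = 1.
Proof.
move=> Hreg ok dD c1; have := degree_decomp v dD.
rewrite Hreg big_split -big_distrr /= => E.
have : \sum_(t <- D) end_count v t <= 2 * count (has_end v) D.
  rewrite -sum1_count big_distrr [X in _ <= X]big_mkcond /=.
  by apply: leq_sum => t _; rewrite /end_count /has_end; do 2!case: eqP.
move: (\sum_(t <- D) _) (\sum_(t <- D) _) E c1 ok => a b; clear; lia.
Qed.

Lemma odd_labeling k : regular_graph e k -> odd k -> 0 < #|T| ->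
  exists f, labeling e f /\ forall v,
    1 + #|edges e|.+1 * k./2 <= vertex_sum e f v
      <= (#|edges e| - k./2) + #|edges e|.+2 * k./2.
Proof.
move=> Hreg ok T0; have [D0 [dD0 uD0]] := trail_decomp_unique_ends.
set m := #|edges e|.
have km : 2 * m = #|T| * k by apply: handshake.
have [t [tD0 kt]] : exists t, t \in D0 /\ k <= size t.2.
  (* Double counting of ends: two per trail, one per vertex. *)
  have sD0 : 2 * size D0 = #|T|.
    transitivity (\sum_(v : T) \sum_(t <- D0) end_count v t).
      rewrite exchange_big /= -sum1_size big_distrr; apply: eq_bigr => t _.
      rewrite /end_count big_split /= -!big_mkcond /=.
      by rewrite !sum1_card !card1.
    by rewrite (eq_bigr (fun=> 1)) ?sum1_card // => v _; apply: odd_end_count.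
  (* If all trails were shorter than [k], then [m] would be at most [(k - 1) * n / 2], less than
     [k * n / 2]. *)
  suff /hasP[t] : has (fun t => k <= size t.2) D0 by exists t.
  rewrite -[has _ _]negbK -all_predC; apply/negP => /allP small.
  have : \sum_(t <- D0) size t.2 <= \sum_(t <- D0) k.-1.
    by rewrite !big_seq; apply: leq_sum => t /small /=; rewrite -ltnNge; clear; lia.
  rewrite (size_decomp dD0) big_const_seq count_predT iter_addn_0 -/m.
  by move: km sD0 T0 ok; clear; nia.
have pD := perm_to_rem tD0; move: (rem t D0) pD => D pD {tD0}.
have dD := perm_trail_decomp pD dD0.
have ed v : \sum_(t <- t :: D) end_count v t = 1.
  by rewrite -(perm_big _ pD); apply: odd_end_count.
have [/allP aD pL] := andP dD; set L := flatten _ in pL.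
have uL : uniq L by rewrite (perm_uniq pL) enum_uniq.
have memL a : (a \in L) = (a \in edges e) by rewrite (perm_mem pL) mem_enum.
have sL : size L = m by rewrite (perm_size pL) -cardE.
have iL a : a \in edges e -> index a L < m by rewrite -memL -sL index_mem.
pose f a := zigzag m (index a L); exists f; split.
  apply: labeling_of_inj => [a /iL|a b ae be]; first exact: zigzag_range.
  move/(zigzag_inj (iL _ ae) (iL _ be)) => E.
  by rewrite -(nth_index set0 (_ : a \in L)) ?memL // E nth_index ?memL.
have so : all (sorted (fun a b => m.+1 <= f a + f b <= m.+2))
    (map trail_edges (t :: D)).
  apply: sorted_flatten; apply/(sortedP set0) => i; rewrite -/L sL => im.
  by have im1 := ltnW im; rewrite /f !index_uniq ?sL //; apply: zigzag_adj.
have late a : a \in edges e -> (index a L == 0) || (k <= (index a L).+1) ->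
    1 <= f a <= m - k./2.
  move=> /iL im il; have := zigzag_range im; rewrite -/(f a) => /andP[-> _] /=.
  case/orP: il => [/eqP E|il]; last exact: zigzag_late.
  rewrite /f E; move: km T0 ok im kt (size_decomp dD); rewrite big_cons.
  rewrite -/m; clear; rewrite /zigzag /=; move: (\sum_(j <- _) _); lia.
(* End edges stand at position 0 or from position [k - 1] on: the long trail [t] comes first, its
   last edge has position at least [k - 1], and all other trails lie beyond it. *)
have endb s : s \in t :: D ->
    1 <= f (head set0 (trail_edges s)) <= m - k./2 /\
    1 <= f (last set0 (trail_edges s)) <= m - k./2.
  move=> sD; have is_ : is_trail s by apply: aD.
  have subL a : a \in trail_edges s -> a \in L.
    by move=> a_s; apply/flattenP; exists (trail_edges s) => //; apply: map_f.
  have ss0 : 0 < size (trail_edges s).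
    by rewrite size_pairmap; case/andP: is_; case: (s.2).
  have hs : head set0 (trail_edges s) \in trail_edges s.
    by case: (trail_edges s) ss0 => //= *; rewrite mem_head.
  have ls : last set0 (trail_edges s) \in trail_edges s.
    by case: (trail_edges s) ss0 => //= *; rewrite mem_last.
  have idx a : a \in trail_edges s -> s \in D -> k <= (index a L).+1.
    move=> a_s s_D; rewrite /L /= index_cat.
    have -> : a \in trail_edges t = false.
      apply/negP => a_t; move: uL; rewrite /L /= cat_uniq => /and3P[_ /hasP[]].
      by exists a => //; apply/flattenP; exists (trail_edges s) => //; apply: map_f.
    by rewrite size_pairmap; apply: leq_trans kt _; rewrite leqW // leq_addr.
  move: sD; rewrite inE => /predU1P[st|s_D].
    have ut : uniq (trail_edges s) by move: uL; rewrite /L /= st cat_uniq => /andP[].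
    split; apply: late; rewrite -?memL ?subL //.
      rewrite /L /= -st index_cat hs.
      by case: (trail_edges s) ss0 => //= a l _; rewrite eqxx.
    rewrite /L /= -st index_cat ls -nth_last index_uniq ?prednK //.
    by rewrite st size_pairmap kt orbT.
  by split; apply: late; rewrite -?memL ?subL ?idx ?orbT.
move=> v; rewrite (vertex_sum_decomp _ _ dD).
have := degree_decomp v dD; rewrite Hreg big_split -big_distrr /= ed => vis.
have half : \sum_(t <- t :: D) visits v t = k./2.
  by rewrite -vis mul2n add1n /= uphalf_double.
have /andP[lo hi] : \sum_(t <- t :: D) (end_count v t + m.+1 * visits v t)
   <= \sum_(t <- t :: D) \sum_(a <- trail_edges t | v \in a) f a
   <= \sum_(t <- t :: D) ((m - k./2) * end_count v t + m.+2 * visits v t).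
  apply: sum_bounds => s sD; have [e1 e2] := endb s sD.
  have := trail_sum_bounds v (aD s sD) (allP so _ (map_f _ sD)).
  rewrite /end_sum /end_count; move: e1 e2; rewrite -/m.
  move: (f (head _ _)) (f (last _ _)) => x y; move: (\sum_(a <- _ | _) _) => S.
  by clear; case: (v == s.1); case: (v == last _ _) => /=; lia.
rewrite big_split -big_distrr /= ed half in lo.
rewrite big_split -!big_distrr /= ed half muln1 in hi.
by rewrite lo hi.
Qed.

End Trails.

(** * Even degree: closed trails, and few odd ones among them *)

Section Even.
Variables (T : finType) (e : rel T).
Hypothesis He : simple_graph e.

Definition closed_trail (t : T * seq T) := last t.1 t.2 == t.1.

(** The start of an open trail would be an end of no other trail, so its degree would be odd. *)
Lemma even_closed k D : regular_graph e k -> ~~ odd k -> trail_decomp e D ->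
  (forall v, count (has_end v) D <= 1) -> all closed_trail D.
Proof.
move=> Hreg ek dD uD; apply/allP => t tD; apply/negPn/negP => nc.
have := degree_decomp He t.1 dD; rewrite Hreg.
have pD := perm_to_rem tD; rewrite (perm_big _ pD) big_cons.
have := uD t.1; rewrite (permP pD) /= {1}/has_end eqxx /= => c0.
rewrite {1}/end_count eqxx (eq_sym t.1) -/(closed_trail t) (negbTE nc).
rewrite big_split -big_distrr /= big_seq big1 => [|s sD].
  by move=> E; move: ek; rewrite -E; clear; lia.
have : ~~ has_end t.1 s.
  by apply: contraL c0 => hs; rewrite -ltnNge ltnS -has_count; apply/hasP; exists s.
by rewrite /has_end /end_count; do 2!case: eqP.
Qed.

(** A closed trail may start at any of its vertices. The final [perm_eq] preserves its length and
    its visit counts. *)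
Lemma closed_trail_rot z t : is_trail e t -> closed_trail t -> z \in t.2 ->
  exists q, [/\ is_trail e (z, q), closed_trail (z, q),
    perm_eq (trail_edges (z, q)) (trail_edges t) & perm_eq q t.2].
Proof.
case: t => x p it ct /= /splitPr pz; case: pz it ct => p1 p2.
rewrite /is_trail /closed_trail /= -cat_rcons last_cat last_rcons cat_path last_rcons.
case/andP=> /andP[p1z zp2] _ /eqP lx; exists (p2 ++ rcons p1 z).
rewrite cat_path lx p1z zp2 last_cat last_rcons eqxx andTb.
split=> //; last by rewrite perm_catC.
  by rewrite -size_eq0 size_cat size_rcons addnS.
by rewrite !trail_edges_cat lx last_rcons perm_catC.
Qed.

Definition odd_trail (t : T * seq T) := odd (size t.2).

Definition odd_length (D : seq (T * seq T)) :=
  \sum_(t <- D | odd_trail t) size t.2.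

Lemma closed_decomp_disjoint_odd D0 : trail_decomp e D0 -> all closed_trail D0 ->
  exists D, [/\ trail_decomp e D, all closed_trail D &
    forall v, \sum_(t <- D | odd_trail t) count_mem v t.2 <= 1].
Proof.
have [n] := ubnP (odd_length D0).
elim: n D0 => // n IH D; rewrite ltnS => lD dD cD.
case: (boolP [forall v, \sum_(t <- D | odd_trail t) count_mem v t.2 <= 1]).
  by move/forallP=> ?; exists D.
rewrite negb_forall => /existsP[v]; rewrite -ltnNge => big_v.
have : (exists t, [/\ t \in D, odd_trail t & 1 < count_mem v t.2])
    \/ 1 < count (fun t => odd_trail t && (v \in t.2)) D.
  case: (boolP (has (fun t => odd_trail t && (1 < count_mem v t.2)) D)).
    by case/hasP=> t tD /andP[ot ct]; left; exists t.
  (* No odd trail visits [v] twice, so the visit counts are indicators and their sum counts the odd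
     trails through [v]. *)
  move/hasPn=> small; right; apply: leq_trans big_v _.
  rewrite -sum1_count big_mkcondr [X in X <= _]big_seq_cond [X in _ <= X]big_seq_cond.
  apply: leq_sum => t /andP[/small + ot]; rewrite ot /= -leqNgt -has_pred1 has_count.
  by case: (count_mem v t.2) => [|[]].
case=> [[t [tD ot ct]]|/count_gt1_perm[t1 [t2 [D' [pD /andP[o1 v1] /andP[o2 v2]]]]]].
  have pD := perm_to_rem tD; move: (rem t D) pD => D' pD.
  have := perm_trail_decomp pD dD; rewrite -[_ :: _]/([:: t] ++ D') => dD'.
  have it : is_trail e t by case/andP: dD => /allP aD _; apply: aD.
  have vt : v \in t.2 by rewrite -has_pred1 has_count; apply: ltnW.
  have [q [iq cq eq pq]] := closed_trail_rot it (allP cD _ tD) vt.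
  have cv : 1 < count_mem v q by rewrite (permP pq).
  have {}cq : last v q == v := cq.
  case/lastP: q iq cq eq pq cv => [|q w] //=; rewrite last_rcons => + /eqP wv.
  rewrite wv -cats1 count_cat /= eqxx addn1 ltnS => iq eq pq cv.
  have : v \in q by rewrite -has_pred1 has_count.
  move=> /splitPr vq; case: vq iq eq pq {cv wv} => q1 q2.
  rewrite -catA cat_cons cats1 -cat_rcons trail_edges_cat last_rcons.
  rewrite /is_trail /= cat_path last_rcons => /andP[/andP[i1 i2] _] eq pq.
  (* The trail, rotated to [v], is cut at an earlier return to [v]. Both pieces are nonempty and
     exactly one is odd, so the odd length drops. *)
  apply: (IH ([:: (v, rcons q1 v); (v, rcons q2 v)] ++ D')).
  - apply: leq_trans _ lD; rewrite /odd_length (perm_big _ pD) !big_cons ot /=.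
    rewrite /odd_trail /=.
    move: ot; rewrite /odd_trail -(perm_size pq) size_cat !size_rcons.
    move: (size q1) (size q2) (\sum_(j <- _ | _) _) => a b c; clear.
    by rewrite oddD; case: (odd a.+1); case: (odd b.+1) => //= _; lia.
  - apply: trail_decomp_sub dD'.
      by rewrite /= /is_trail /= i1 i2 -!size_eq0 !size_rcons.
    by rewrite /= !cats0.
  - move: cD; rewrite (perm_all _ pD) /= => /andP[_ ->].
    by rewrite /closed_trail /= !last_rcons !eqxx.
have := perm_trail_decomp pD dD; rewrite -[_ :: _]/([:: t1; t2] ++ D') => dD'.
have /and3P[i1 i2 _] : all (is_trail e) (t1 :: t2 :: D') by case/andP: dD'.
have /and3P[c1 c2 cD'] : all closed_trail (t1 :: t2 :: D') by rewrite -(perm_all _ pD).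
have [p1 [j1 d1 e1 s1]] := closed_trail_rot i1 c1 v1.
have [p2 [j2 d2 e2 s2]] := closed_trail_rot i2 c2 v2.
move: j1 j2 d1 d2; rewrite /is_trail /closed_trail /= => /andP[a1 n1]
  /andP[a2 n2] /eqP l1 /eqP l2.
(* Joined at [v], the two odd trails form an even one, which no longer counts. *)
apply: (IH ((v, p1 ++ p2) :: D')).
- apply: leq_trans _ lD; rewrite /odd_length (perm_big _ pD) !big_cons o1 o2 /=.
  move: o1 o2; rewrite /odd_trail /= size_cat -(perm_size s1) -(perm_size s2) oddD => o1 o2.
  rewrite o1 o2 /=; move: o1 (\sum_(j <- _ | _) _).
  by case: (size p1) => //; clear; lia.
- rewrite -cat1s; apply: trail_decomp_sub dD'.
    by rewrite /= andbT /is_trail /= cat_path a1 l1 a2; case: (p1) n1.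
  by rewrite /= !cats0 trail_edges_cat l1 perm_cat.
by apply/andP; split; [rewrite /closed_trail /= last_cat l1 l2 | exact: cD'].
Qed.

(** [t.2] omits the start but ends with the same vertex, so the base point is counted there once. *)
Lemma count_closed_trail v t : is_trail e t -> closed_trail t ->
  count_mem v t.2 = (v == t.1) + visits v t.
Proof.
case: t => x [|y q]; rewrite /is_trail ?andbF //= => _ /eqP /= <-.
transitivity (count_mem v (rcons (belast y q) (last y q))).
  by rewrite -lastI.
by rewrite -cats1 count_cat /= addn0 addnC eq_sym.
Qed.

(** At the base point the last and first edges form one more adjacent pair, so every visit costs
    between [A] and [B]. *)
Lemma closed_trail_sum_bounds (F : {set T} -> nat) A B v t :
  is_trail e t -> closed_trail t ->
  sorted (fun a b => A <= F a + F b <= B) (trail_edges t) ->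
  A <= F (last set0 (trail_edges t)) + F (head set0 (trail_edges t)) <= B ->
  A * count_mem v t.2 <= \sum_(a <- trail_edges t | v \in a) F a
    <= B * count_mem v t.2.
Proof.
move=> it ct so cl; have := trail_sum_bounds He v it so.
rewrite /end_sum (eqP ct) count_closed_trail //.
move: cl; move: (F (head _ _)) (F (last _ _)) => x y.
move: (\sum_(a <- _ | _) _) => S.
by clear; case: (v == _) => /=; lia.
Qed.

Lemma closed_decomp_degree k D v : regular_graph e k -> trail_decomp e D ->
  all closed_trail D -> \sum_(t <- D) count_mem v t.2 = k./2.
Proof.
move=> Hreg dD cD; rewrite -(doubleK (\sum_(t <- D) _)); congr _./2.
rewrite -(Hreg v) -(degree_decomp He v dD) -mul2n big_distrr !big_seq /=.
apply: eq_bigr => t tD; rewrite count_closed_trail ?(allP cD) //.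
  by rewrite /end_count (eqP (allP cD _ tD)) mulnDr mul2n -addnn.
by case/andP: dD => /allP aD _; apply: aD.
Qed.

Lemma sum_count_mem (s : seq T) : \sum_(v : T) count_mem v s = size s.
Proof.
elim: s => [|x s IH] /=; first by rewrite big1.
rewrite big_split /= IH -big_mkcond /= (eq_bigl (pred1 x)) => [|y].
  by rewrite sum1_card card1.
by rewrite eq_sym.
Qed.

Lemma size_closed_trail t : is_trail e t -> closed_trail t -> 1 < size t.2.
Proof.
case: t => x [|y [|z q]] //; rewrite /is_trail /closed_trail /= !andbT.
by move=> exy /eqP yx; move: exy; rewrite yx; have [_ ->] := He.
Qed.

Lemma find_flatten (A B : eqType) (h : A -> seq B) x0 s i b :
  uniq (flatten (map h s)) -> i < size s -> b \in h (nth x0 s i) ->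
  find (fun x => b \in h x) s = i.
Proof.
elim: s i => //= x s IH [|i]; rewrite cat_uniq => /and3P[_ dis us] li bi.
  by rewrite bi.
have -> : b \in h x = false.
  apply/negP => bx; case/hasP: dis; exists b => //.
  by apply/flattenP; exists (h (nth x0 s i)) => //; apply/map_f/mem_nth.
by rewrite (IH i).
Qed.

Lemma uniq_flatten (A : eqType) (ss : seq (seq A)) s :
  uniq (flatten ss) -> s \in ss -> uniq s.
Proof.
move=> us /perm_to_rem/perm_flatten/perm_uniq; rewrite us /= cat_uniq.
by case: (uniq s).
Qed.

(** Provides the ordering that the level labels presuppose: trail [i] is odd exactly when
    [i < c]. *)
Lemma odd_trails_first k : regular_graph e k -> ~~ odd k ->
  exists D c, [/\ trail_decomp e D, all closed_trail D,
    forall v, \sum_(t <- D | odd_trail t) count_mem v t.2 <= 1,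
    c <= size D & forall t0 i, i < size D -> odd_trail (nth t0 D i) = (i < c)].
Proof.
move=> Hreg ek; have [D0 [dD0 uD0]] := trail_decomp_unique_ends He.
have cD0 := even_closed Hreg ek dD0 uD0.
have [D [dD cD oD]] := closed_decomp_disjoint_odd dD0 cD0.
have pD : perm_eq D (filter odd_trail D ++ filter (predC odd_trail) D).
  by rewrite perm_sym; apply/permPl/perm_filterC.
exists (filter odd_trail D ++ filter (predC odd_trail) D).
exists (size (filter odd_trail D)).
split=> [|||| t0 i].
- exact: perm_trail_decomp dD.
- by rewrite -(perm_all _ pD).
- by move=> v; rewrite -(perm_big _ pD).
- by rewrite size_cat leq_addr.
rewrite size_cat nth_cat => lt; case: ltnP => li.
  by have := mem_nth t0 li; rewrite mem_filter => /andP[].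
have : i - size (filter odd_trail D) < size (filter (predC odd_trail) D).
  by rewrite ltn_subLR.
by move/(mem_nth t0); rewrite mem_filter => /andP[/negbTE].
Qed.

(** An odd closed trail makes at least three visits, and each vertex receives at most one visit from
    all odd trails together. *)
Lemma card_odd_trails D c : trail_decomp e D -> all closed_trail D ->
  (forall v, \sum_(t <- D | odd_trail t) count_mem v t.2 <= 1) ->
  c <= size D -> (forall t0 i, i < size D -> odd_trail (nth t0 D i) = (i < c)) ->
  3 * c <= #|T|.
Proof.
move=> dD cD oD lc oc; have ec : \sum_(t <- D | odd_trail t) 1 = c.
  case: D lc oc {dD cD oD} => [|t0 D1] lc oc; first by rewrite big_nil; case: c lc {oc}.
  rewrite big_mkcond (big_nth t0) big_mkord -[RHS](sum_ltn_ord lc).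
  by apply: eq_bigr => i _; rewrite oc //; case: (_ < _).
rewrite -ec big_distrr /=; apply: (@leq_trans (\sum_(t <- D | odd_trail t) size t.2)).
  rewrite big_seq_cond [X in _ <= X]big_seq_cond; apply: leq_sum => t /andP[tD ot].
  have it : is_trail e t by case/andP: dD => /allP aD _; apply: aD.
  have := size_closed_trail it (allP cD _ tD); move: ot; rewrite /odd_trail.
  by case: (size t.2) => [|[|[|]]].
rewrite (eq_bigr (fun t => \sum_(v : T) count_mem v t.2)) => [|t _].
  rewrite exchange_big /= -sum1_card; apply: leq_sum => v _; exact: oD.
by rewrite sum_count_mem.
Qed.

Lemma even_labeling k : regular_graph e k -> ~~ odd k -> 0 < k -> 0 < #|T| ->
  exists f c, [/\ labeling e f, 3 * c <= #|T| & forall v,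
    #|edges e|.+1 * k./2 <= vertex_sum e f v + (k./2.-1 + maxn 1 c) /\
    vertex_sum e f v <= #|edges e|.+1 * k./2 + (k./2.-1 + maxn 1 c)].
Proof.
move=> Hreg ek k0 /card_gt0P[u _].
have [D [c [dD cD oD lc oc]]] := odd_trails_first Hreg ek.
have c3 := card_odd_trails dD cD oD lc oc.
pose t0 : T * seq T := (u, [::]); pose tr := nth t0 D.
pose d := size D; pose len i := size (tr i).2.
have itr i : i < d -> is_trail e (tr i).
  by move=> li; case/andP: dD => /allP aD _; apply/aD/mem_nth.
have ctr i : i < d -> closed_trail (tr i) by move=> li; apply/(allP cD)/mem_nth.
have odd_len i : i < d -> odd (len i) = (i < c) by apply: oc.
have len_gt1 i : i < d -> 1 < len i.
  by move=> li; apply: size_closed_trail; [apply: itr | apply: ctr].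
set m := #|edges e|; have em : level_count d c len = m.
  by rewrite level_count_sum // /m -(size_decomp dD) (big_nth t0) big_mkord.
have [_ pL] := andP dD; set L := flatten _ in pL.
have uL : uniq L by rewrite (perm_uniq pL) enum_uniq.
have memL a : (a \in L) = (a \in edges e) by rewrite (perm_mem pL) mem_enum.
have st i : size (trail_edges (tr i)) = len i by rewrite size_pairmap.
(* An edge is labeled by the index of its trail and its position there; [find] is unambiguous
   because the trails share no edge. *)
pose f a := let i := find (fun t => a \in trail_edges t) D in
  level_label d c len i (index a (trail_edges (tr i))).
have fE i q : i < d -> q < len i ->
    f (nth set0 (trail_edges (tr i)) q) = level_label d c len i q.
  move=> li lq; have a_t := mem_nth set0 (etrans (congr1 (ltn q) (st i)) lq).
  rewrite /f (find_flatten uL li a_t) index_uniq ?st //.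
  by apply: uniq_flatten uL _; apply/map_f/mem_nth.
have edgeP a : a \in edges e -> exists i q,
    [/\ i < d, q < len i & a = nth set0 (trail_edges (tr i)) q].
  rewrite -memL => /flattenP[s /mapP[t tD ->] a_t].
  exists (index t D), (index a (trail_edges t)); rewrite /len /tr nth_index //.
  by rewrite nth_index // index_mem; split=> //; rewrite -index_mem size_pairmap in a_t.
exists f, c; split; [|exact: c3|].
  apply: labeling_of_inj => [a /edgeP[i [q [li lq ->]]]|a b].
    by rewrite fE // -/m -em; apply: level_label_range.
  move=> /edgeP[i [q [li lq ->]]] /edgeP[j [r [lj lr ->]]].
  by rewrite !fE // => /(level_label_inj lc odd_len li lj lq lr)[-> ->].
pose w t := if odd_trail t then c else 1.
have bal t v : t \in D -> (m.+1 - w t) * count_mem v t.2 <=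
    \sum_(a <- trail_edges t | v \in a) f a <= (m.+1 + w t) * count_mem v t.2.
  move=> tD; have li : index t D < d by rewrite index_mem.
  have et : t = tr (index t D) by rewrite /tr nth_index.
  move: (index t D) li et => i li ->.
  have ew : window c i = w (tr i) by rewrite /window /w oc.
  have bE s : balanced d c len (window c i) s ->
      m.+1 - w (tr i) <= s <= m.+1 + w (tr i).
    by rewrite /balanced em ew leq_subLR addnC => -[-> ->].
  apply: closed_trail_sum_bounds; rewrite ?itr ?ctr //.
    apply/(sortedP set0) => q; rewrite st => lq.
    by rewrite !fE ?(ltnW lq) //; apply/bE/level_label_adj.
  have l0 : 0 < len i := ltnW (len_gt1 _ li).
  rewrite -nth_last -nth0 st !fE ?prednK //.
  by apply/bE/level_label_close.
move=> v; rewrite (vertex_sum_decomp _ _ dD).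
have deg := closed_decomp_degree v Hreg dD cD.
(* Of the [k./2] visits to [v] at most one belongs to an odd trail, with error [c]; each other visit
   has error 1. *)
have wsum : \sum_(t <- D) w t * count_mem v t.2 <= k./2.-1 + maxn 1 c.
  have -> : \sum_(t <- D) w t * count_mem v t.2 =
     c * (\sum_(t <- D | odd_trail t) count_mem v t.2) +
     \sum_(t <- D | ~~ odd_trail t) count_mem v t.2.
    rewrite (bigID odd_trail) big_distrr /=; congr (_ + _); apply: eq_bigr => t.
      by rewrite /w => ->.
    by rewrite /w => /negbTE ->; rewrite mul1n.
  move: deg (oD v); rewrite (bigID odd_trail) /=.
  have k2 : 0 < k./2 by move: ek k0; clear; lia.
  move: k2; move: (\sum_(t <- D | odd_trail t) _) => x.
  move: (\sum_(t <- D | ~~ odd_trail t) _) => y.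
  by clear; case: x => [|[|]] //; lia.
set W := \sum_(t <- D) w t * _ in wsum.
set V := \sum_(t <- D) _.
have lo : m.+1 * k./2 <= V + W.
  rewrite -deg big_distrr -big_split /= !big_seq; apply: leq_sum => t tD.
  by have /andP[+ _] := bal t v tD; rewrite mulnBl leq_subLR addnC.
have hi : V <= m.+1 * k./2 + W.
  rewrite -deg big_distrr -big_split /= /V !big_seq; apply: leq_sum => t tD.
  by have /andP[_] := bal t v tD; rewrite mulnDl.
by split; [apply: leq_trans lo _ | apply: leq_trans hi _]; rewrite leq_add2l.
Qed.

End Even.

(** * The graph without vertices, and the final arithmetic *)

(** Treated apart because the labelings above assume a vertex and because the odd bound is then -1;
    the condition on sums is vacuous. *)
Lemma approx_magic_empty (T : finType) (e : rel T) (delta : rat) :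
  #|T| = 0 -> approx_magic e delta.
Proof.
move=> T0; have noT (x : T) : False by have := card0_eq T0 x; rewrite inE.
exists (fun=> 0); split; last by move=> x; case: (noT x).
have E0 : edges e = set0.
  by apply/setP => a; rewrite inE; apply/negP => /imsetP[[x]]; case: (noT x).
by split; rewrite E0 ?cards0; [move=> a|move=> a b|case]; rewrite ?inE.
Qed.

Import GRing.Theory Num.Theory.

Theorem theorem1p4 (T : finType) (e : rel T) (k : nat)
    (He : simple_graph e) (Hreg : regular_graph e k) (Hk : 1 <= k) :
  (odd k -> approx_magic e (#|T|%:R * k%:R / 2%:R - 1)%R) /\
  (~~ odd k -> approx_magic e (2%:R * #|T|%:R / 3%:R + k%:R - 1)%R).
Proof.
have [T0|T0] := posnP #|T|; first by split=> _; apply: approx_magic_empty.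
have m2 := handshake He Hreg; split=> [ok|ek].
  have [f [lf fb]] := odd_labeling He Hreg ok T0; exists f; split=> // u v _ _.
  (* The interval of possible sums has length [m - 1], and [m] is [n * k / 2]. *)
  have H : vertex_sum e f u + 1 <= vertex_sum e f v + #|edges e|.
    have /andP[_] := fb u; have /andP[+ _] := fb v; rewrite !mulSn.
    have : k./2 <= #|edges e| by move: m2 T0; clear; nia.
    move: (vertex_sum e f u) (vertex_sum e f v) (_ * _) => x y z.
    by clear; lia.
  move: H; rewrite -(ler_nat rat) -natrM -m2 natrM !natrD.
  by move: (_ u)%:R%R (_ v)%:R%R (#|_|)%:R%R => x y z; clear; lra.
have [f [c [lf c3 fb]]] := even_labeling He Hreg ek Hk T0.
exists f; split=> // u v _ _.
have H : 3 * vertex_sum e f u + 3 <= 3 * vertex_sum e f v + 2 * #|T| + 3 * k.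
  have [_] := fb u; have [+ _] := fb v.
  (* Needed when [c = 0]: the spread is then at most [k], and [n >= k >= 2] makes [2 * n / 3 - 1]
     nonnegative. *)
  have : k <= #|T| by rewrite -(Hreg u) max_card.
  move: (vertex_sum e f u) (vertex_sum e f v) (_ * k./2) => x y z.
  by move: Hk ek c3; clear; lia.
move: H; rewrite -(ler_nat rat) 3!natrD !natrM.
by move: (_ u)%:R%R (_ v)%:R%R (#|_|)%:R%R k%:R%R => x y z t; clear; lra.
Qed.
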